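(* Let $\mathbb{K}$ be a field and $R=\mathbb{K}[x_1,\dots,x_n]$. If $I\subset R$ is an unmixed ass-decomposable monomial ideal, then $\sqrt{I}$ is also ass-decomposable.
   Context: For an ideal $I\subseteq R$, $\mathrm{ass}(I)$ is the set of associated primes of $R/I$. An ideal $I$ is unmixed if $\dim R/I=\dim R/\mathfrak{p}$ for all $\mathfrak{p}\in\mathrm{ass}(I)$. Recursively, a (proper) monomial ideal $I\subset R$ is called ass-decomposable if either it is a primary ideal, or else there exist a variable $x_i\notin\sqrt{I}$ and a positive integer $k$ such that (i) $\mathrm{ass}(I+(x_i^k))=\{\mathfrak{p}\in\mathrm{ass}(I) : x_i\in\mathfrak{p}\}$, and (ii) both $I+(x_i^k)$ and $I:x_i^k$ are ass-decomposable. *)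

(* Defs.v *)
From HB Require Import structures.
From mathcomp Require Import all_boot all_order all_algebra.
From mathcomp Require Import boolp classical_sets.
From mathcomp Require Import mpoly.

Set Implicit Arguments.
Unset Strict Implicit.
Unset Printing Implicit Defensive.

Import GRing.Theory.

Local Open Scope classical_set_scope.
Local Open Scope ring_scope.

(* Ideals are Prop-valued subsets [set R]; the closure predicates of
   ring_quotient are boolean and force the ideal to be proper, which is too
   restrictive for sums, colons and generated ideals. *)
Section Ideals.
Variable R : comNzRingType.
Implicit Types (I J p : set R) (x f g : R).

Definition is_ideal I : Prop :=
  [/\ I 0,
      forall f g, I f -> I g -> I (f + g)
    & forall f g, I g -> I (f * g)].

Definition is_proper_ideal I : Prop := is_ideal I /\ ~ I 1.

Definition is_prime_ideal p : Prop :=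
  is_proper_ideal p /\ forall f g, p (f * g) -> p f \/ p g.

Definition radical I : set R := [set f | exists2 k, (0 < k)%N & I (f ^+ k)].

Definition is_primary_ideal I : Prop :=
  is_proper_ideal I /\ forall f g, I (f * g) -> I f \/ radical I g.

Definition ideal_gen (G : set R) : set R := smallest is_ideal G.

Definition ideal_add I J : set R := [set f + g | f in I & g in J].

(* I : x *)
Definition ideal_colon I x : set R := [set f | I (f * x)].

(* Associated primes of the module R/I, as a set of ideals of R: the primes
   [set g | I (g * f)], which is the annihilator of the class of f in R/I. *)
Definition ass I : set (set R) :=
  [set p | is_prime_ideal p /\ exists f, p = ideal_colon I f].

(* A chain of primes P_0 < ... < P_d of R/I, seen as primes of R that
   contain I. *)
Definition prime_chain I (d : nat) (P : nat -> set R) : Prop :=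
  (forall i, (i <= d)%N -> is_prime_ideal (P i) /\ I `<=` P i) /\
  (forall i, (i < d)%N -> P i `<` P i.+1).

(* dim R/I = d (Krull dimension) *)
Definition dim_quot_eq I (d : nat) : Prop :=
  (exists P, prime_chain I d P) /\
  (forall e P, prime_chain I e P -> (e <= d)%N).

(* dim R/I = dim R/p, stated through [dim_quot_eq], for every p in ass I. *)
Definition unmixed I : Prop :=
  forall p, ass I p -> forall d, dim_quot_eq I d <-> dim_quot_eq p d.

End Ideals.

Section Monomial.
Variables (K : fieldType) (n : nat).
Implicit Type I : set {mpoly K[n]}.

Definition monomial_ideal I : Prop :=
  exists M : set 'X_{1..n},
    I = ideal_gen [set ('X_[m] : {mpoly K[n]}) | m in M].

(* The recursion is read as a least fixed point. It is well founded: under the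
   hypotheses of the second constructor, both I + (x_i^k) and I : x_i^k
   strictly contain I. *)
Inductive ass_decomposable I : Prop :=
| AssDecPrimary of
    monomial_ideal I & is_proper_ideal I & is_primary_ideal I
| AssDecSplit (i : 'I_n) (k : nat) of
    monomial_ideal I & is_proper_ideal I &
    ~ radical I 'X_i & (0 < k)%N &
    ass (ideal_add I (ideal_gen [set ('X_i ^+ k : {mpoly K[n]})]))
      = [set p | ass I p /\ p 'X_i] &
    ass_decomposable (ideal_add I (ideal_gen [set ('X_i ^+ k : {mpoly K[n]})]))
    & ass_decomposable (ideal_colon I ('X_i ^+ k)).

End Monomial.

(* Main.v *)
Require Import Defs.
From HB Require Import structures.
From mathcomp Require Import all_boot all_order all_algebra.
From mathcomp Require Import boolp classical_sets.
From mathcomp Require Import mpoly.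

Set Implicit Arguments.
Unset Strict Implicit.
Unset Printing Implicit Defensive.

Import GRing.Theory.

Local Open Scope classical_set_scope.
Local Open Scope ring_scope.

(** The monomial primes are the ideals P_S generated by the variables x_i with
    i in S, and the radical of a monomial ideal I is the intersection of the
    P_S for S in F(I), the antichain of minimal such S ([radical_monomial]).
    Passing to complements, F(I) is the list of facets of a simplicial complex.
    Adding x_i to the radical is deletion of the vertex i, and taking the colon
    by x_i is its link, so for squarefree ideals ass-decomposability is vertex
    decomposability, the condition on associated primes being the shedding
    condition ([cap_primes_split]).

    Unmixedness makes ass I an antichain for inclusion
    ([unmixed_ass_antichain]): if p < q are associated primes, a chain of
    maximal length above q is lengthened by p, whereas R/p and R/q have the
    same dimension.  This needs R/p to have a dimension at all, that is, a bound
    on the length of chains of primes of a polynomial ring.  If f_i lies in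
    P_{i+1} but not in P_i, then no nonzero polynomial over K takes at the f_i a
    value in P_0: its lexicographically lowest monomial would survive
    ([lex_sum_notin]).  As n+1 polynomials in n variables are
    algebraically dependent, chains have length at most n
    ([prime_chain_bound]).

    The antichain property is inherited by J = I + (x_i^k) and L = I : x_i^k,
    all of whose associated primes belong to ass I.  It forces every associated
    prime to be minimal; as minimal primes are associated ([min_primes_ass]),
    the minimal primes of J are exactly the minimal primes of I that contain
    x_i ([min_primes_add]).  The minimal primes of L avoiding x_i are those of
    I avoiding x_i ([min_primes_colon]), but if k is small L may retain
    minimal primes that contain x_i, so the radical of L need not be the colon
    of the radical of I by x_i.  The induction therefore proves more: for each
    set u of variables, the intersection of the minimal primes of I avoiding u
    is ass-decomposable or the unit ideal ([ass_decomposable_link]).  This is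
    the analogue of the fact that links in a vertex decomposable complex are
    vertex decomposable.  The members of F(I) avoiding u and i are then
    supplied by L with u + i in place of u, and the members avoiding u and
    containing i by J.  The theorem is the case where u is empty. *)

(** * Ideals *)

Section IdealFacts.
Variable R : comNzRingType.
Implicit Types (I J p G : set R) (x f g : R).

Lemma ideal_opp I f : is_ideal I -> I f -> I (- f).
Proof. by move=> [_ _ IM] If; rewrite -mulN1r; apply: IM. Qed.

Lemma ideal_mulr I f g : is_ideal I -> I f -> I (f * g).
Proof. by move=> [_ _ IM] If; rewrite mulrC; apply: IM. Qed.

Lemma ideal_sum (T : Type) (r : seq T) (Q : pred T) (F : T -> R) I :
  is_ideal I -> (forall i, Q i -> I (F i)) -> I (\sum_(i <- r | Q i) F i).
Proof.
by move=> [I0 ID IM] H; apply: (big_ind I) => // x y; apply: ID.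
Qed.

Lemma prime_expr p f k : is_prime_ideal p -> p (f ^+ k) -> p f.
Proof.
move=> [[_ p1] pM]; elim: k => [|k IHk]; first by rewrite expr0.
by rewrite exprS => /pM [].
Qed.

Lemma ideal_gen_ideal G : is_ideal (ideal_gen G).
Proof.
split=> [J [[]]//|f g If Ig J HJ|f g Ig J HJ]; have [[J0 JD JM] GJ] := HJ.
  by apply: JD; [apply: If | apply: Ig].
by apply: JM; apply: Ig.
Qed.

Lemma ideal_add_gen_sub I J x : is_ideal I -> is_ideal J ->
  (ideal_add I (ideal_gen [set x]) `<=` J) <-> (I `<=` J /\ J x).
Proof.
move=> idI idJ; have [J0 JD _] := idJ; have [I0 _ _] := idI; split.
  move=> sub; split=> [f If|]; apply: sub.
    by exists f => //; exists 0; rewrite ?addr0 //; case: (ideal_gen_ideal [set x]).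
  by exists 0 => //; exists x; rewrite ?add0r //; apply: sub_gen_smallest.
move=> [IJ Jx] _ [f If [g Gg <-]]; apply: JD; first exact: IJ.
by apply: Gg; split=> // _ ->.
Qed.

(** In the binomial expansion of the power a + b of a sum, each term has
    exponent at least a on the left or at least b on the right. *)
Lemma radical_ideal I : is_ideal I -> is_ideal (radical I).
Proof.
move=> idI; have [I0 ID IM] := idI; split.
- by exists 1%N; rewrite ?expr1.
- move=> f g [a a0 Ia] [b b0 Ib]; exists (a + b)%N; first by rewrite addn_gt0 a0.
  rewrite exprDn; apply: ideal_sum => // i _; rewrite -mulr_natl; apply: (IM).
  have [ltib|lebi] := ltnP i b.
    by rewrite -addnBA 1?ltnW // exprD -mulrA; apply: ideal_mulr.
  by rewrite -[X in g ^+ X](subnK lebi) exprD mulrA; apply: IM.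
- by move=> f g [k k0 Igk]; exists k => //; rewrite exprMn; apply: IM.
Qed.

Lemma radical_primary_prime I : is_primary_ideal I -> is_prime_ideal (radical I).
Proof.
move=> [[idI I1] primI]; split.
  by split; [apply: radical_ideal | move=> [k _]; rewrite expr1n].
move=> f g [k k0]; rewrite exprMn => /primI [If|[l l0]]; first by left; exists k.
by rewrite -exprM => Ig; right; exists (k * l)%N; rewrite ?muln_gt0 ?k0.
Qed.

Lemma prime_primary p : is_prime_ideal p -> is_primary_ideal p.
Proof.
move=> [pr pM]; split=> // f g /pM [pf|pg]; [by left | right].
by exists 1%N; rewrite ?expr1.
Qed.

(** The annihilator of f modulo (I : x) is the annihilator of f x modulo I. *)
Lemma ass_colon_sub I x : ass (ideal_colon I x) `<=` ass I.
Proof.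
move=> p [pr_p [f def_p]]; split=> //; exists (f * x).
by rewrite def_p; apply/seteqP; split=> g; rewrite /ideal_colon /= mulrA.
Qed.

End IdealFacts.

(** * Chains of primes in a polynomial ring *)

Section KrullDimension.

(** Among the exponents of A, which agree before position j, only those with
    the least j-th coordinate matter: after cancelling that power of f_j, which
    is legitimate modulo the prime P_j, every other term is a multiple of f_j and
    vanishes modulo P_{j+1}.  Iterating isolates the lexicographically least
    exponent, whose coefficient would have to lie in the last prime. *)
Lemma lex_sum_notin (R : comNzRingType) (e N : nat) (P : nat -> set R) (f : nat -> R)
    (c : {ffun 'I_e -> 'I_N} -> R)
    (primeP : forall i, (i <= e)%N -> is_prime_ideal (P i))
    (subP : forall i, (i < e)%N -> P i `<=` P i.+1)
    (f_in : forall i, (i < e)%N -> P i.+1 (f i))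
    (f_notin : forall i, (i < e)%N -> ~ P i (f i))
    (j : nat) (A : {set {ffun 'I_e -> 'I_N}}) :
  (j <= e)%N -> A != finset.set0 ->
  {in A, forall a, ~ P e (c a)} ->
  {in A &, forall a b : {ffun 'I_e -> 'I_N}, forall i : 'I_e, (i < j)%N -> a i = b i} ->
  ~ P j (\sum_(a in A) c a * \prod_(i < e | (j <= i)%N) f i ^+ a i).
Proof.
move=> le_je; move Dd: (e - j)%N => d.
elim: d => [|d IHd] in j A le_je Dd *.
  (* All coordinates are now fixed, so A is a singleton. *)
  have {Dd le_je}-> : j = e by apply/eqP; rewrite eqn_leq le_je -subn_eq0 Dd.
  case/set0Pn=> a aA cA eqA.
  rewrite (big_pred1 a) => [|b /=]; last first.
    apply/idP/eqP=> [bA|->//]; apply/ffunP=> i.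
    exact: (eqA b a bA aA i (ltn_ord i)).
  rewrite big_pred0 => [|i]; last by rewrite leqNgt ltn_ord.
  by rewrite mulr1; apply: cA.
have lt_je : (j < e)%N by rewrite -subn_gt0 Dd.
pose jo := Ordinal lt_je.
case/set0Pn=> a1 a1A cA eqA.
case: (@arg_minnP _ a1 (fun a => a \in A) (fun a => val (a jo)) a1A) => /= a0 a0A a0min.
pose A' := [set a in A | a jo == a0 jo]%SET.
pose rest a := c a * (f j ^+ (a jo - a0 jo) *
                      \prod_(i < e | (j.+1 <= i)%N) f i ^+ a i).
have idP i : (i <= e)%N -> is_ideal (P i) by move=> /primeP [[]].
have -> : \sum_(a in A) c a * \prod_(i < e | (j <= i)%N) f i ^+ a i
        = f j ^+ a0 jo * \sum_(a in A) rest a.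
  rewrite mulr_sumr; apply: eq_bigr => a aA.
  rewrite (bigD1 jo) //= /rest [RHS]mulrCA; congr (_ * _).
  rewrite mulrA -exprD subnKC ?a0min //; congr (_ * _).
  by apply: eq_bigl => i; rewrite ltn_neqAle andbC eq_sym.
case/(primeP j le_je).2 => [/(prime_expr (primeP j le_je))|]; first exact: f_notin.
move/(subP j lt_je).
rewrite (bigID (fun a : {ffun 'I_e -> 'I_N} => a jo == a0 jo)) /= => PS.
have Prest : P j.+1 (\sum_(a in A | a jo != a0 jo) rest a).
  apply: ideal_sum => [|a /andP [aA ne_a]]; first exact: idP.
  have lt_a : (0 < a jo - a0 jo)%N.
    by rewrite subn_gt0 ltn_neqAle a0min // andbT eq_sym.
  rewrite /rest -(prednK lt_a) exprS -mulrA mulrCA.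
  by apply: (ideal_mulr _ (idP _ lt_je)); apply: f_in.
have [_ PD _] := idP _ lt_je.
apply: (IHd j.+1 A') => //; rewrite ?subnS ?Dd //.
- by apply/set0Pn; exists a0; rewrite inE a0A eqxx.
- by move=> a; rewrite inE => /andP [/cA].
- move=> a b; rewrite !inE => /andP [aA /eqP aj] /andP [bA /eqP bj] i.
  rewrite ltnS leq_eqVlt => /orP [/eqP ij|]; last exact: eqA.
  by rewrite (_ : i = jo) ?aj ?bj //; apply: val_inj.
have := PD _ _ PS (ideal_opp (idP _ lt_je) Prest); rewrite addrK.
congr (P _ _); apply: eq_big => [a|a /andP [aA /eqP aj]]; first by rewrite inE.
by rewrite /rest aj subnn expr0 mul1r.
Qed.

Variables (K : fieldType) (n : nat).
Implicit Type f : nat -> {mpoly K[n]}.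

Lemma msize_prod_exp f (e N D : nat) (a : {ffun 'I_e -> 'I_N}) :
  (forall i, (i < e)%N -> (msize (f i) <= D.+1)%N) ->
  (msize (\prod_(i < e) f i ^+ a i) <= (e * (N * D)).+1)%N.
Proof.
move=> szf.
have szM (p q : {mpoly K[n]}) s t :
    (msize p <= s.+1 -> msize q <= t.+1 -> msize (p * q) <= (s + t).+1)%N.
  have [->|p0] := eqVneq p 0; first by rewrite mul0r msize0.
  have [->|q0] := eqVneq q 0; first by rewrite mulr0 msize0.
  rewrite msizeM // => sp sq; have := leq_add sp sq; rewrite addSn addnS.
  by case: (msize p + msize q)%N.
have szX (p : {mpoly K[n]}) k : (msize p <= D.+1 -> msize (p ^+ k) <= (k * D).+1)%N.
  move=> sp; elim: k => [|k IHk]; first by rewrite expr0 msize1.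
  by rewrite exprS mulSn; apply: szM.
rewrite -[in X in (_ <= X.+1)%N](card_ord e) -sum1_card big_distrl /=.
apply: (big_ind2 (fun p s => msize p <= s.+1)%N) => [||i _].
- by rewrite msize1.
- by move=> p1 s1 p2 s2; apply: szM.
rewrite mul1n (leq_trans (szX _ _ (szf _ (ltn_ord i)))) // ltnS.
by rewrite leq_mul2r (ltnW (ltn_ord _)) orbT.
Qed.

(** By counting: the N^e products with exponents less than N have degree O(N), so
    they lie in a space of dimension O(N^n), which is less than N^e for N
    large. *)
Lemma algebraic_dependence f (e : nat) : (n < e)%N ->
  exists N, exists2 v : {ffun 'I_e -> 'I_N} -> K,
    (exists a, v a != 0) &
    \sum_a v a *: \prod_(i < e) f i ^+ a i = 0.
Proof.
move=> lt_ne.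
pose D := (\max_(i < e) msize (f i))%N.
have szf i : (i < e)%N -> (msize (f i) <= D.+1)%N.
  move=> lt_ie; rewrite ltnW // ltnS.
  exact: (leq_bigmax (F := fun i : 'I_e => msize (f i)) (Ordinal lt_ie)).
(* With this N, B <= N (eD+1) gives B^n <= N^n (eD+1)^n < N^(n+1) <= N^e. *)
pose N := ((e * D).+1 ^ n).+1.
pose B := (e * (N * D)).+1.
pose E : finType := {ffun 'I_e -> 'I_N}.
pose M : finType := {ffun 'I_n -> 'I_B}.
have ltME : (#|M| < #|E|)%N.
  rewrite !card_ffun !card_ord.
  apply: (@leq_ltn_trans ((N * (e * D).+1) ^ n)).
    have leB : (B <= N * (e * D).+1)%N by rewrite /B mulnCA mulnS -add1n leq_add.
    by case: (n) => // n'; rewrite leq_exp2r.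
  rewrite expnMn; apply: (@leq_trans (N ^ n.+1)).
    by rewrite expnSr ltn_pmul2l ?expn_gt0.
  by rewrite leq_exp2l // ltnS expn_gt0.
pose mon (a : E) := \prod_(i < e) f i ^+ a i.
pose mnm_of (b : M) := [multinom val (b i) | i < n].
pose A : 'M[K]_(#|E|, #|M|) := \matrix_(a, b)
  (mon (enum_val a))@_(mnm_of (enum_val b)).
have /rowV0Pn [v /sub_kermxP vA v0] : kermx A != 0.
  rewrite -mxrank_eq0 mxrank_ker -lt0n subn_gt0.
  exact: leq_ltn_trans (rank_leq_col _) ltME.
exists N, (fun a => v 0 (enum_rank a)).
  by have [a va] := rV0Pn _ v0; exists (enum_val a); rewrite enum_valK.
apply/mpolyP=> m; rewrite mcoeff0 raddf_sum /=.
have [mB | [i mi]] : (forall i, m i < B)%N \/ exists i, (B <= m i)%N.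
  have [/forallP|/forallPn [i]] := boolP [forall i, (m i < B)%N]; first by left.
  by rewrite -leqNgt => mi; right; exists i.
(* Monomials with all exponents below B are the columns of A; the others
   have too large a degree to occur. *)
- pose b : M := [ffun i => Ordinal (mB i)].
  have := congr1 (fun w : 'rV_#|M| => w 0 (enum_rank b)) vA.
  rewrite !mxE => vAb.
  rewrite -[RHS]vAb [RHS](reindex_onto (@enum_rank E) enum_val) /=; last first.
    by move=> a _; rewrite enum_valK.
  apply: eq_big => [a|a _]; first by rewrite /= enum_rankK eqxx.
  rewrite mcoeffZ !mxE !enum_rankK; congr (_ * _@__).
  by apply/mnmP=> i; rewrite mnmE ffunE.
apply: big1 => a _; rewrite mcoeffZ memN_msupp_eq0 ?mulr0 //.
apply: msize_mdeg_ge; apply: leq_trans (msize_prod_exp a szf) _.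
apply: leq_trans mi _.
by rewrite mdegE (bigD1 i) //= leq_addr.
Qed.

Lemma prime_chain_bound (I : set {mpoly K[n]}) (e : nat) P :
  prime_chain I e P -> (e <= n)%N.
Proof.
move=> [primeP ltP]; rewrite leqNgt; apply/negP=> lt_ne.
have stepP (i : nat) : exists x, (i < e)%N -> P i.+1 x /\ ~ P i x.
  have [/ltP [_]|] := pselect (i < e)%N; last by exists 0.
  by move=> /existsNP [x /not_implyP [Px nPx]]; exists x.
have [f Hf] := choice stepP.
have [N [v [a0 va0] /eqP]] := algebraic_dependence f lt_ne.
pose A := [set a | v a != 0]%SET.
rewrite (bigID (fun a => v a != 0)) /= [X in _ + X]big1 ?addr0; last first.
  by move=> a /negPn /eqP ->; rewrite scale0r.
move=> /eqP dep.
have prP i (le : (i <= e)%N) := (primeP i le).1.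
have [] := @lex_sum_notin _ e N P f (fun a => (v a)%:MP) prP _ _ _ 0 A.
- by move=> i /ltP [].
- by move=> i /Hf [].
- by move=> i /Hf [].
- by [].
- by apply/set0Pn; exists a0; rewrite inE.
- move=> a; rewrite inE => va Pa; have [[_ _ PM] nP1] := (prP e (leqnn e)).1.
  by apply: nP1; have := PM (v a)^-1%:MP _ Pa; rewrite -mpolyCM mulVf ?mpolyC1.
- by [].
have [[P0 _ _] _] := (prP 0%N isT).1.
suff -> : \sum_(a in A) (v a)%:MP * \prod_(i < e | (0 <= i)%N) f i ^+ a i = 0 by [].
rewrite -[RHS]dep; apply: eq_big => [a|a _]; first by rewrite inE.
by rewrite mul_mpolyC.
Qed.

(** [unmixed] compares dimensions only through the integers that satisfy
    [dim_quot_eq]; existence of such an integer makes it informative. *)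
Lemma dim_prime_exists (p : set {mpoly K[n]}) :
  is_prime_ideal p -> exists d, dim_quot_eq p d.
Proof.
move=> pr_p; pose Q d := `[< exists P, prime_chain p d P >].
have exQ : exists d, Q d.
  by exists 0%N; apply/asboolP; exists (fun=> p); split=> // i _; split.
have bQ d : Q d -> (d <= n)%N by move/asboolP=> [P /prime_chain_bound].
case: (ex_maxnP exQ bQ) => d /asboolP chd dmax; exists d; split=> // e P che.
by apply: dmax; apply/asboolP; exists P.
Qed.

Lemma unmixed_ass_antichain (I p q : set {mpoly K[n]}) :
  unmixed I -> ass I p -> ass I q -> p `<=` q -> p = q.
Proof.
move=> unmI ap aq pq; apply: contrapT => neq.
have pr_p : is_prime_ideal p := ap.1.
have [d dimp] := dim_prime_exists pr_p.
have [[P [primeP ltP]] _] : dim_quot_eq q d.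
  by apply/(unmI q aq)/(unmI p ap).
suff chp : prime_chain p d.+1 (fun i => if i is j.+1 then P j else p).
  by have := dimp.2 _ _ chp; rewrite ltnn.
split.
- move=> [_|i]; first by split.
  rewrite ltnS => /primeP [prPi qPi].
  by split=> //; apply: subset_trans qPi.
move=> [_|i] /=; last exact: ltP.
have qP0 := (primeP 0%N isT).2; split; first exact: subset_trans qP0.
by move=> P0p; apply: neq; apply/seteqP; split=> //; apply: subset_trans P0p.
Qed.

End KrullDimension.

(** * Monomial primes and monomial ideals *)

Section MonomialIdeals.
Variables (K : fieldType) (n : nat).
Implicit Types (I J p : set {mpoly K[n]}) (S T : {set 'I_n}).
Implicit Types (m w : 'X_{1..n}) (F : set {set 'I_n}).

Definition meets S m : bool := [exists j, (j \in S) && (m j != 0%N)].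

(** The ideal generated by the variables indexed by S, described by supports so
    that membership is decided monomial by monomial. *)
Definition var_prime S : set {mpoly K[n]} :=
  [set f | forall m, m \in msupp f -> meets S m].

Definition cap_primes F : set {mpoly K[n]} :=
  [set f | forall S, F S -> var_prime S f].

Definition antichain F : Prop :=
  forall S T, F S -> F T -> S \subset T -> S = T.

Definition min_primes I : set {set 'I_n} :=
  [set S | minset (fun T => `[< I `<=` var_prime T >]) S].

(** The product of the variables outside S lies in P_T exactly when T is not
    contained in S, so it separates P_S from the other members of an
    antichain. *)
Definition outside S : 'X_{1..n} := [multinom (i \notin S : nat) | i < n].

Lemma meetsP S m : reflect (exists2 j, j \in S & m j != 0%N) (meets S m).
Proof. exact: exists_inP. Qed.

Lemma meetsD S m1 m2 : meets S (m1 + m2)%MM = meets S m1 || meets S m2.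
Proof.
apply/meetsP/orP => [[j jS]|[] /meetsP [j jS nz]].
- rewrite mnmDE addn_eq0 negb_and => /orP [] nz; [left|right];
    by apply/meetsP; exists j.
- by exists j; rewrite // mnmDE addn_eq0 negb_and nz.
- by exists j; rewrite // mnmDE addn_eq0 negb_and nz orbT.
Qed.

Lemma meetsU S i : meets S U_(i)%MM = (i \in S).
Proof.
apply/meetsP/idP=> [[j jS]|iS].
  by rewrite mnm1E; case: (i =P j) => [->|].
by exists i; rewrite // mnm1E eqxx.
Qed.

Lemma meets_sub S T m : S \subset T -> meets S m -> meets T m.
Proof.
by move=> /fintype.subsetP sub /meetsP [j /sub jT nz]; apply/meetsP; exists j.
Qed.

Lemma meets_outside S T : meets T (outside S) = ~~ (T \subset S).
Proof.
apply/meetsP/subsetPn => [[j jT]|[j jT jS]].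
  by rewrite mnmE eqb0 negbK => jS; exists j.
by exists j; rewrite // mnmE jS.
Qed.

Lemma var_primeX S m : var_prime S 'X_[m] <-> meets S m.
Proof.
split=> [|mS m']; first by apply; rewrite msuppX inE.
by rewrite msuppX inE => /eqP ->.
Qed.

Lemma var_primeXU S i : var_prime S 'X_i <-> i \in S.
Proof. by rewrite var_primeX meetsU. Qed.

Lemma var_prime_sub S T : S \subset T -> var_prime S `<=` var_prime T.
Proof. by move=> sub f Sf m /Sf; apply: meets_sub. Qed.

Lemma var_prime_ideal S : is_ideal (var_prime S).
Proof.
split=> [m|f g Sf Sg m|f g Sg m].
- by rewrite msupp0.
- by move/msuppD_le; rewrite mem_cat => /orP [/Sf|/Sg].
- move/msuppM_le/allpairsP => [[m1 m2] /= [_ /Sg m2S ->]].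
  by rewrite meetsD m2S orbT.
Qed.

(** The endomorphism sending the variables of S to 0.  Its kernel is P_S, which
    is prime because the target is a domain. *)
Definition kill S (f : {mpoly K[n]}) : {mpoly K[n]} :=
  f \mPo [tuple (if i \in S then 0 else 'X_i) | i < n].

Lemma killX S m : kill S 'X_[m] = if meets S m then 0 else 'X_[m].
Proof.
rewrite /kill comp_mpolyX; case: (boolP (meets S m)) => [/meetsP [j jS nz]|mS].
  by rewrite (bigD1 j) //= tnth_mktuple jS expr0n (negPf nz) mul0r.
rewrite mpolyXE_id; apply: eq_bigr => i _; rewrite tnth_mktuple.
case: ifP => // iS; suff -> : m i = 0%N by [].
by apply: contraNeq mS => nz; apply/meetsP; exists i.
Qed.

Lemma mcoeff_kill S f m : (kill S f)@_m = if meets S m then 0 else f@_m.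
Proof.
have -> : kill S f = \sum_(k <- msupp f) f@_k *: kill S 'X_[k].
  exact: comp_mpolyEX.
rewrite [f in RHS]mpolyE !raddf_sum /=.
case: ifP => mS.
  apply: big1 => k _; rewrite killX mcoeffZ.
  case: ifP => kS; first by rewrite mcoeff0 mulr0.
  rewrite mcoeffX; case: eqP => [km|_]; last by rewrite mulr0n mulr0.
  by rewrite km mS in kS.
apply: eq_bigr => k _; rewrite killX !mcoeffZ.
case: ifP => // kS; rewrite mcoeff0 mcoeffX; case: eqP => [km|_]; last by rewrite mulr0n.
by rewrite km mS in kS.
Qed.

Lemma kill_eq0 S f : kill S f = 0 <-> var_prime S f.
Proof.
split=> [f0 m|Sf].
  rewrite mcoeff_msupp; have := mcoeff_kill S f m; rewrite f0 mcoeff0.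
  by case: ifP => // _ <-; rewrite eqxx.
apply/mpolyP=> m; rewrite mcoeff_kill mcoeff0; case: ifP => // mS.
by apply: memN_msupp_eq0; apply/negP => /Sf; rewrite mS.
Qed.

Lemma var_prime_prime S : is_prime_ideal (var_prime S).
Proof.
split; first split; first exact: var_prime_ideal.
  by rewrite -mpolyX0 var_primeX => /meetsP [j _]; rewrite mnm0E.
move=> f g /kill_eq0; rewrite /kill rmorphM => /eqP; rewrite mulf_eq0.
by case/orP => /eqP /kill_eq0; [left|right].
Qed.

Lemma ideal_mnm_le I m m' :
  is_ideal I -> I 'X_[m] -> (m <= m')%MM -> I 'X_[m'].
Proof. by move=> [_ _ IM] Im le; rewrite -(submK le) mpolyXD; apply: IM. Qed.

Lemma ideal_of_supp I f :
  is_ideal I -> (forall m, m \in msupp f -> I 'X_[m]) -> I f.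
Proof.
move=> idI If; have [_ _ IM] := idI.
rewrite [f]mpolyE big_seq; apply: ideal_sum => // m mf.
by rewrite -mul_mpolyC; apply: IM; apply: If.
Qed.

(** For the direct implication, the polynomials each of whose monomials is
    divisible by a generator form an ideal. *)
Lemma monomial_idealP I : monomial_ideal I <->
  is_ideal I /\ (forall f, I f -> forall m, m \in msupp f -> I 'X_[m]).
Proof.
split=> [[M ->]|[idI suppI]].
  split=> [|f If m mf]; first exact: ideal_gen_ideal.
  pose J : set {mpoly K[n]} :=
    [set g | forall m, m \in msupp g -> exists2 m', M m' & (m' <= m)%MM].
  suff /(_ m mf) [m' Mm' le] : J f.
    apply: (ideal_mnm_le (ideal_gen_ideal _) _ le).
    by apply: sub_gen_smallest; exists m'.
  apply: If; split; last first.
    move=> _ [m' Mm' <-] k; rewrite msuppX inE => /eqP ->.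
    by exists m' => //; apply: lepm_refl.
  split=> [k|g h Jg Jh k|g h Jh k].
  - by rewrite msupp0.
  - by move/msuppD_le; rewrite mem_cat => /orP [/Jg|/Jh].
  - move/msuppM_le/allpairsP => [[m1 m2] /= [_ /Jh [m' Mm' le] ->]].
    by exists m' => //; apply: lepm_trans le (lem_addl _ _).
exists [set m | I 'X_[m]]; apply/seteqP; split=> f.
  move=> If; apply: ideal_of_supp; first exact: ideal_gen_ideal.
  by move=> m /(suppI f If) Im; apply: sub_gen_smallest; exists m.
by apply; split=> // _ [m Im <-].
Qed.

Lemma cap_primes_ideal F : is_ideal (cap_primes F).
Proof.
split=> [S FS|f g Ff Fg S FS|f g Fg S FS]; have [S0 SD SM] := var_prime_ideal S.
- exact: S0.
- by apply: SD; [apply: Ff | apply: Fg].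
- by apply: SM; apply: Fg.
Qed.

Lemma cap_primes_monomial F : monomial_ideal (cap_primes F).
Proof.
apply/monomial_idealP; split=> [|f Ff m mf S FS]; first exact: cap_primes_ideal.
by apply/var_primeX; apply: Ff mf.
Qed.

Lemma cap_primes_proper F S : F S -> is_proper_ideal (cap_primes F).
Proof.
move=> FS; split=> [|F1]; first exact: cap_primes_ideal.
by have [[_]] := var_prime_prime S; case; apply: F1.
Qed.

Lemma cap_primes1 S : cap_primes [set S] = var_prime S.
Proof. by apply/seteqP; split=> f; [by move=> /(_ S erefl) | move=> Sf _ ->]. Qed.

Lemma min_primes_sub I S : min_primes I S -> I `<=` var_prime S.
Proof. by move=> /minsetp/asboolP. Qed.

Lemma min_primes_antichain I : antichain (min_primes I).
Proof.
move=> S T minS minT ST; apply: (minsetinf minT) => //.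
exact/asboolP/min_primes_sub.
Qed.

Lemma min_primes_below I T :
  I `<=` var_prime T -> exists2 S, min_primes I S & S \subset T.
Proof.
move=> IT; pose Q U := `[< I `<=` var_prime U >].
by have /(@minset_exists _ Q) [S] : Q T by [apply/asboolP]; exists S.
Qed.

Lemma min_primesP I S : min_primes I S <->
  I `<=` var_prime S /\ forall T, I `<=` var_prime T -> T \subset S -> T = S.
Proof.
split=> [minS|[IS minS]].
  split=> [|T IT TS]; first exact: min_primes_sub.
  by apply: (minsetinf minS) => //; apply/asboolP.
by apply/minsetP; split=> [|T /asboolP]; [apply/asboolP | apply: minS].
Qed.

Lemma min_primes_exists I :
  monomial_ideal I -> is_proper_ideal I -> exists S, min_primes I S.
Proof.
move=> /monomial_idealP [_ suppI] [_ I1].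
have [|S] := @min_primes_below I finset.setT; last by exists S.
move=> f If m /(suppI f If) Im; apply: contrapT => /negP mT; apply: I1.
rewrite -mpolyX0 (_ : 0%MM = m) //; apply/mnmP=> i; rewrite mnm0E; apply/esym/eqP.
by apply: contraNT mT => nz; apply/meetsP; exists i.
Qed.

(** If a monomial x^m lies in every monomial prime over I, the set T of variables
    not dividing it gives a P_T that does not contain I.  So I has a monomial in
    the variables dividing x^m, and a power of x^m is a multiple of it. *)
Lemma radical_monomial I :
  monomial_ideal I -> radical I = cap_primes (min_primes I).
Proof.
move=> /monomial_idealP [idI suppI]; apply/seteqP; split=> f.
  move=> [k k0 If] S /min_primes_sub IS.
  by apply: (prime_expr (var_prime_prime S)); apply: IS If.
move=> Ff; apply: ideal_of_supp => [|m mf]; first exact: radical_ideal.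
pose T := [set j | m j == 0%N]%SET.
have nT : ~~ meets T m by apply/meetsP => -[j]; rewrite inE => /eqP ->.
have [IT|] := pselect (I `<=` var_prime T).
  have [S minS ST] := min_primes_below IT.
  by rewrite (meets_sub ST (Ff S minS m mf)) in nT.
move=> /existsNP [g /not_implyP [Ig /existsNP [w /not_implyP [/(suppI g Ig) Iw wT]]]].
exists (mdeg w).+1 => //; rewrite mpolyXn; apply: (ideal_mnm_le idI Iw).
apply/mnm_lepP=> j; rewrite mulmnE.
have [mj|mj] := eqVneq (m j) 0%N.
  rewrite mj mul0n leqn0; apply/negPn/negP => nz; apply: wT; apply/meetsP.
  by exists j; rewrite // inE mj.
apply: (@leq_trans (mdeg w)); first by rewrite mdegE (bigD1 j) //= leq_addr.
by rewrite (leq_trans (leqnSn _)) // leq_pmull // lt0n.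
Qed.

(** * Associated primes of monomial ideals *)

(** Let u be the product of the variables outside S.  Minimality of S
    gives, for each i in S, a monomial of I in x_i and the variables outside S.
    So the monomials w such that no w u^N lies in I have bounded degree in the
    variables of S.  Take w of maximal degree.  Then for N large x_i w u^N lies
    in I for each i in S, and the annihilator of w u^N modulo I is P_S. *)
Lemma min_primes_ass I S :
  monomial_ideal I -> min_primes I S -> ass I (var_prime S).
Proof.
move=> /monomial_idealP [idI suppI] /min_primesP [IS minS].
have [I0 ID IM] := idI.
pose u := outside S.
have uS N : ~~ meets S (u *+ N)%MM.
  apply/meetsP => -[j jS]; rewrite mulmnE mnmE jS; by rewrite mul0n.
(* M i is a monomial of I that involves no variable of S other than x_i. *)
have exM (i : 'I_n) :
    exists m, i \in S -> I 'X_[m] /\ ~~ meets (S :\ i)%SET m.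
  have [iS|] := boolP (i \in S); last by exists 0%MM.
  have /existsNP [f /not_implyP [If]] : ~ I `<=` var_prime (S :\ i)%SET.
    move=> sub; have /setP /(_ i) := minS _ sub (subsetDl _ _).
    by rewrite !inE eqxx iS.
  by move=> /existsNP [m /not_implyP [/(suppI f If) Im /negP mS]]; exists m.
have [M HM] := choice exM.
pose good w := forall N, ~ I 'X_[w + u *+ N].
have good_lt w i : good w -> i \in S -> (w i < M i i)%N.
  move=> gw iS; have [IMi nMi] := HM i iS; rewrite ltnNge; apply/negP => le.
  apply: (gw (mdeg (M i))); apply: ideal_mnm_le idI IMi _.
  apply/mnm_lepP => j; rewrite mnmDE mulmnE mnmE.
  have [->|ne_ji] := eqVneq j i; first by rewrite (leq_trans le) ?leq_addr.
  have [jS|jS] /= := boolP (j \in S).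
    rewrite (_ : M i j = 0%N) //; apply: contraNeq nMi => nz.
    by apply/meetsP; exists j; rewrite // !inE ne_ji.
  by rewrite mul1n mdegE (bigD1 j) //= addnA addnAC leq_addl.
pose Q d := `[< exists2 w, good w & d = \sum_(i in S) w i >]%N.
have exQ : exists d, Q d.
  exists (\sum_(i in S) (0%MM : 'X_{1..n}) i)%N; apply/asboolP; exists 0%MM => // N.
  by rewrite add0m => /IS /var_primeX; apply/negP.
have bQ d : Q d -> (d <= \sum_(i in S) M i i)%N.
  move=> /asboolP [w gw ->]; apply: leq_sum => i iS.
  by rewrite ltnW // good_lt.
case: (ex_maxnP exQ bQ) => d /asboolP [w gw ->] wmax.
have exN (i : 'I_n) : exists N, i \in S -> I 'X_[w + U_(i) + u *+ N].
  have [iS|] := boolP (i \in S); last by exists 0%N.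
  have [//|nI] := pselect (exists N, I 'X_[w + U_(i) + u *+ N]).
    by move=> [N IN]; exists N.
  have gwi : good (w + U_(i))%MM by move=> N IN; apply: nI; exists N.
  have : (\sum_(j in S) (w + U_(i))%MM j <= \sum_(j in S) w j)%N.
    by apply: wmax; apply/asboolP; exists (w + U_(i))%MM.
  rewrite leqNgt => /negP; case.
  rewrite (bigD1 i) // [X in (_ < X)%N](bigD1 i) //= mnmDE mnm1E eqxx addn1.
  rewrite addSn ltnS leq_add2l; apply: leq_sum => j _.
  by rewrite mnmDE leq_addr.
have [Nf HN] := choice exN.
pose N := (\max_(i < n) Nf i)%N.
split; first exact: var_prime_prime.
exists 'X_[w + u *+ N]; apply/seteqP; split=> f.
  move=> Sf; rewrite /ideal_colon /= [f]mpolyE mulr_suml big_seq.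
  apply: ideal_sum => // m /Sf /meetsP [i iS nz].
  rewrite -mul_mpolyC -mulrA -mpolyXD; apply: (IM).
  apply: ideal_mnm_le idI (HN i iS) _; apply/mnm_lepP => j.
  rewrite !mnmDE !mulmnE mnm1E addnCA addnA leq_add //.
    rewrite leq_add2l; case: eqP => // <-; by rewrite lt0n.
  by rewrite leq_mul2l (leq_bigmax (F := Nf)) orbT.
rewrite /ideal_colon /= => If m mf; apply: contrapT => /negP mS.
apply: (gw (N + mdeg m)%N).
have mf' : (w + u *+ N + m)%MM \in msupp (f * 'X_[w + u *+ N]).
  by rewrite mcoeff_msupp mcoeffMX -mcoeff_msupp.
apply: ideal_mnm_le idI (suppI _ If _ mf') _; apply/mnm_lepP => j.
rewrite !mnmDE !mulmnE mnmE mulnDr addnA leq_add2l.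
have [jS|jS] /= := boolP (j \in S).
  rewrite (_ : m j = 0%N) //; apply: contraNeq mS => nz.
  by apply/meetsP; exists j.
by rewrite mul1n mdegE (bigD1 j) //= leq_addr.
Qed.

Lemma var_prime_outside S T : var_prime T 'X_[outside S] <-> ~~ (T \subset S).
Proof. by rewrite var_primeX meets_outside. Qed.

(** If S and T were distinct members of F, the product of the variables outside S
    would lie in all the primes except P_S, and likewise for T.  The product of
    these two monomials would then lie in the intersection, and neither factor
    would. *)
Lemma cap_primes_prime F : antichain F -> is_prime_ideal (cap_primes F) ->
  exists2 S, F S & F = [set S].
Proof.
move=> antiF [[_ F1] primeF].
have [S FS] : exists S, F S.
  by apply: contrapT => nF; apply: F1 => S FS; case: nF; exists S.
exists S => //; apply/seteqP; split=> T /=; last by move=> ->.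
move=> FT; apply: contrapT => ne_TS.
have TS : ~~ (T \subset S) by apply/negP => /(antiF T S FT FS).
have ST : ~~ (S \subset T) by apply/negP => /(antiF S T FS FT) /esym.
have /primeF [/(_ S FS)|/(_ T FT)] :
    cap_primes F ('X_[outside S] * 'X_[outside T]).
- move=> U FU; have [US|US] := boolP (U \subset S).
    rewrite (antiF U S FU FS US); have [_ _ PM] := var_prime_ideal S.
    exact: (PM _ _ ((var_prime_outside T S).2 ST)).
  exact: (ideal_mulr _ (var_prime_ideal U) ((var_prime_outside S U).2 US)).
- by move/var_prime_outside; rewrite subxx.
- by move/var_prime_outside; rewrite subxx.
Qed.

Lemma ideal_colon_cap_primes F f :
  ideal_colon (cap_primes F) f = cap_primes [set S | F S /\ ~ var_prime S f].
Proof.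
apply/seteqP; split=> g Hg S.
  move=> [FS Sf]; have [_ pM] := var_prime_prime S.
  by case: (pM g f (Hg S FS)).
move=> FS; have [_ _ SM] := var_prime_ideal S.
have [Sf|Sf] := pselect (var_prime S f); first exact: SM.
by apply: (ideal_mulr _ (var_prime_ideal S)); apply: Hg.
Qed.

(** The colon by f drops the primes that contain f; it is prime exactly when one
    is left, and the product of the variables outside S leaves P_S alone. *)
Lemma cap_primes_ass F : antichain F ->
  ass (cap_primes F) = [set var_prime S | S in F].
Proof.
move=> antiF; apply/seteqP; split=> p /=.
  move=> [pr_p [f def_p]]; move: def_p pr_p; rewrite ideal_colon_cap_primes => ->.
  case/cap_primes_prime => [S T [FS _] [FT _]|S [FS _] ->]; first exact: antiF.
  by exists S; rewrite ?cap_primes1.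
move=> [S FS <-]; split; first exact: var_prime_prime.
exists 'X_[outside S]; rewrite ideal_colon_cap_primes -cap_primes1; congr cap_primes.
apply/seteqP; split=> T /=.
  by move=> ->; split=> //; rewrite var_prime_outside subxx.
move=> [FT]; rewrite var_prime_outside => /negP/negPn; exact: antiF.
Qed.

(** * Decomposing radicals *)

(** The third hypothesis is the shedding condition: it says that deleting the
    vertex i creates no facet other than those of F that miss i.  (The members of F
    are the complements of the facets.)  So if f lies in P_S for all S in F with
    i in S, removing from f its terms divisible by x_i leaves an element of the
    whole intersection. *)
Lemma cap_primes_split F (i : 'I_n) : antichain F ->
  (exists2 S, F S & i \notin S) ->
  (forall S, F S -> i \notin S ->
     exists T, [/\ F T, i \in T & T \subset (i |: S)%SET]) ->
  ass_decomposable (cap_primes [set S | F S /\ i \in S]) ->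
  ass_decomposable (cap_primes [set S | F S /\ i \notin S]) ->
  ass_decomposable (cap_primes F).
Proof.
move=> antiF [S0 FS0 iS0] shed decI decN.
have addE : ideal_add (cap_primes F) (ideal_gen [set 'X_i ^+ 1])
          = cap_primes [set S | F S /\ i \in S].
  apply/seteqP; split.
    apply/ideal_add_gen_sub; [exact: cap_primes_ideal| exact: cap_primes_ideal|].
    split=> [f Ff S [FS _]|S [_ iS]]; first exact: Ff.
    by rewrite expr1; apply/var_primeXU.
  move=> f Ff; exists (kill [set i]%SET f).
    move=> S FS m; rewrite mcoeff_msupp mcoeff_kill.
    case: ifP => [|mi]; rewrite ?eqxx // -mcoeff_msupp => mf.
    have [iS|iS] := boolP (i \in S); first exact: (Ff S).
    have [T [FT iT TS]] := shed S FS iS.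
    have /(meets_sub TS) := Ff T (conj FT iT) m mf.
    move=> /meetsP [j]; rewrite in_setU1 => /orP [/eqP -> nz|jS nz].
      by case/meetsP: mi; exists i; rewrite ?inE.
    by apply/meetsP; exists j.
  exists (f - kill [set i]%SET f); last by rewrite addrC subrK.
  apply: ideal_of_supp; first exact: ideal_gen_ideal.
  move=> m; rewrite mcoeff_msupp mcoeffB mcoeff_kill; case: ifP; last first.
    by rewrite subrr eqxx.
  move=> /meetsP [j]; rewrite inE => /eqP -> nz _.
  apply: (ideal_mnm_le (m := U_(i)%MM)); first exact: ideal_gen_ideal.
    by apply: sub_gen_smallest; rewrite /= expr1.
  apply/mnm_lepP => k; rewrite mnm1E; case: eqP => // <-; by rewrite lt0n.
apply: (@AssDecSplit _ _ _ i 1) => //.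
- exact: cap_primes_monomial.
- exact: cap_primes_proper FS0.
- move=> [k _ /(_ S0 FS0) /(prime_expr (var_prime_prime _)) /var_primeXU iS].
  by rewrite iS in iS0.
- rewrite addE !cap_primes_ass //; last by move=> S T [FS _] [FT _]; apply: antiF.
  apply/seteqP; split=> p /=.
    by move=> [S [FS iS] <-]; split; [exists S | apply/var_primeXU].
  by move=> [[S FS <-] /var_primeXU iS]; exists S.
- by rewrite addE.
- rewrite expr1 ideal_colon_cap_primes.
  rewrite (_ : [set S | F S /\ ~ var_prime S 'X_i] = [set S | F S /\ i \notin S]) //.
  by apply/seteqP; split=> S /= [FS iS]; split=> //;
    [apply/negP => /var_primeXU | move/var_primeXU; apply/negP].
Qed.

Lemma ass_decomposable_var_prime S : ass_decomposable (cap_primes [set S]).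
Proof.
apply: AssDecPrimary; first exact: cap_primes_monomial.
  by apply: (cap_primes_proper (S := S)).
by rewrite cap_primes1; apply/prime_primary/var_prime_prime.
Qed.

(** What remains of unmixedness in the induction: unlike [unmixed], it passes to
    ideals whose associated primes are among those of I. *)
Definition ass_antichain I : Prop :=
  forall p q, ass I p -> ass I q -> p `<=` q -> p = q.

Lemma ass_antichain_sub I J :
  ass J `<=` ass I -> ass_antichain I -> ass_antichain J.
Proof. by move=> sub anti p q /sub Ip /sub Iq; apply: anti. Qed.

Lemma var_prime_inj S T : var_prime S = var_prime T -> S = T.
Proof.
move=> eqST; apply/setP=> i; apply/idP/idP => /var_primeXU.
  by rewrite eqST => /var_primeXU.
by rewrite -eqST => /var_primeXU.
Qed.

Lemma ass_decomposable_monomial I : ass_decomposable I -> monomial_ideal I.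
Proof. by case. Qed.

Lemma var_primeXUn S i k : (0 < k)%N -> var_prime S ('X_i ^+ k) <-> i \in S.
Proof.
case: k => // k _; split=> [/(prime_expr (var_prime_prime S))/var_primeXU //|iS].
by rewrite exprS; apply: (ideal_mulr _ (var_prime_ideal S)); apply/var_primeXU.
Qed.

Lemma add_sub_var_prime I i k T : (0 < k)%N -> is_ideal I ->
  ideal_add I (ideal_gen [set 'X_i ^+ k]) `<=` var_prime T <->
  I `<=` var_prime T /\ i \in T.
Proof.
move=> k0 idI; rewrite ideal_add_gen_sub //; last exact: var_prime_ideal.
by rewrite var_primeXUn.
Qed.

(** A minimal prime of J is associated to J, hence to I; among the
    associated primes of I, an antichain, it must be minimal over I. *)
Lemma min_primes_add I (i : 'I_n) k : (0 < k)%N -> monomial_ideal I ->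
  let J := ideal_add I (ideal_gen [set 'X_i ^+ k]) in
  monomial_ideal J -> ass_antichain I ->
  ass J = [set p | ass I p /\ p 'X_i] ->
  min_primes J = [set S | min_primes I S /\ i \in S].
Proof.
move=> k0 monI J monJ antiI assJ.
have [idI _] := (monomial_idealP I).1 monI.
have JP T := add_sub_var_prime i T k0 idI.
apply/seteqP; split=> S /=.
  move=> minS; have := min_primes_ass monJ minS; rewrite assJ => -[assS /var_primeXU iS].
  split=> //; have [IS _] := (JP S).1 (min_primes_sub minS).
  have [T minT TS] := min_primes_below IS.
  suff /var_prime_inj <- : var_prime T = var_prime S by [].
  by apply: antiI; [apply: min_primes_ass | | apply: var_prime_sub].
move=> [/min_primesP [IS minS] iS]; apply/min_primesP; split; first exact/JP.
by move=> T /JP [IT _]; apply: minS.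
Qed.

(** Modulo a prime P_T with i not in T, the power of x_i can be cancelled. *)
Lemma min_primes_colon I (i : 'I_n) k S : monomial_ideal I -> i \notin S ->
  min_primes (ideal_colon I ('X_i ^+ k)) S <-> min_primes I S.
Proof.
move=> /monomial_idealP [idI _] iS.
have colP T : i \notin T ->
    ideal_colon I ('X_i ^+ k) `<=` var_prime T <-> I `<=` var_prime T.
  move=> iT; split=> sub f If.
    by apply: sub; apply: ideal_mulr.
  have [_ TM] := var_prime_prime T.
  case: (TM _ _ (sub _ If)) => // /(prime_expr (var_prime_prime T)).
  by move/var_primeXU; rewrite (negPf iT).
have out T : T \subset S -> i \notin T.
  by move=> /fintype.subsetP TS; apply: contra iS => /TS.
split=> /min_primesP [IS minS]; apply/min_primesP; split; try exact/colP.
  by move=> T IT TS; apply: minS => //; apply/colP => //; apply: out.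
by move=> T IT TS; apply: minS => //; apply/colP => //; apply: out.
Qed.

Lemma disjoint_setU1 (T : finType) (A B : {set T}) (x : T) :
  [disjoint A & (x |: B)%SET]%B = (x \notin A) && [disjoint A & B]%B.
Proof.
by rewrite !(disjoint_sym A) -disjointU1; apply: eq_disjoint => y; rewrite !inE.
Qed.

(** If i is in u, everything comes from the colon ideal.  Otherwise the family
    of minimal primes avoiding u inherits the shedding condition of I at i,
    since the T found below S + i still avoids u.  When no member avoids i, the
    family is already that of I + (x_i^k). *)
Lemma ass_decomposable_link I : ass_decomposable I -> ass_antichain I ->
  forall u : {set 'I_n}, (exists S, min_primes I S /\ [disjoint S & u]%B) ->
  ass_decomposable (cap_primes [set S | min_primes I S /\ [disjoint S & u]%B]).
Proof.
elim=> {I} [I monI propI primI|I i k monI propI nrad k0 assJ decJ IHJ decL IHL]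
  antiI u [S0 [minS0 S0u]].
  have [|S FS FE] := cap_primes_prime (@min_primes_antichain I).
    by rewrite -radical_monomial //; apply: radical_primary_prime.
  rewrite (_ : [set _ | _] = [set S]); first exact: ass_decomposable_var_prime.
  move: minS0; rewrite FE /= => S0S; apply/seteqP; split=> T /=; first by case.
  by move=> ->; rewrite -S0S.
set J := ideal_add I _ in assJ decJ IHJ; set L := ideal_colon I _ in decL IHL.
have minJ := min_primes_add k0 monI (ass_decomposable_monomial decJ) antiI assJ.
rewrite -/J in minJ.
have subJ : ass J `<=` ass I by rewrite assJ => p [].
have {}IHJ := IHJ (ass_antichain_sub subJ antiI).
have {}IHL := IHL (ass_antichain_sub (@ass_colon_sub _ _ _) antiI).
have disjU S : [disjoint S & (i |: u)%SET]%B = (i \notin S) && [disjoint S & u]%B.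
  exact: disjoint_setU1.
have decN : (exists S, min_primes I S /\ [disjoint S & (i |: u)%SET]%B) ->
    ass_decomposable
      (cap_primes [set S | min_primes I S /\ [disjoint S & (i |: u)%SET]%B]).
  have minL S : [disjoint S & (i |: u)%SET]%B -> min_primes L S <-> min_primes I S.
    by rewrite disjU => /andP [iS _]; apply: min_primes_colon.
  move=> [S [minS Su]]; have := IHL (i |: u)%SET.
  rewrite (_ : [set T | min_primes L T /\ _]
             = [set T | min_primes I T /\ [disjoint T & (i |: u)%SET]%B]).
    by apply; exists S; split=> //; apply/minL.
  by apply/seteqP; split=> T /= [minT Tu]; split=> //; apply/minL.
have [iu|iu] := boolP (i \in u).
  have iuE : (i |: u)%SET = u by apply/setP=> j; rewrite in_setU1; case: eqP => // ->.
  by rewrite iuE in decN; apply: decN; exists S0.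
have decI : (exists S, (min_primes I S /\ [disjoint S & u]%B) /\ i \in S) ->
    ass_decomposable
      (cap_primes [set S | (min_primes I S /\ [disjoint S & u]%B) /\ i \in S]).
  move=> [S [[minS Su] iS]]; have := IHJ u; rewrite minJ.
  rewrite (_ : [set T : {set 'I_n} | _ /\ [disjoint T & u]%B]
             = [set T | (min_primes I T /\ [disjoint T & u]%B) /\ i \in T]).
    by apply; exists S.
  by apply/seteqP; split=> T /=; tauto.
(* I + (x_i^k) lies in P_{S + i}, so one of its minimal primes lies below. *)
have shed S : min_primes I S /\ [disjoint S & u]%B -> i \notin S ->
    exists T, [/\ min_primes I T /\ [disjoint T & u]%B, i \in T
                & T \subset (i |: S)%SET].
  move=> [minS Su] iS; have [idI _] := (monomial_idealP I).1 monI.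
  have [|T] := @min_primes_below J (i |: S)%SET.
    apply/add_sub_var_prime => //; rewrite setU11; split=> //.
    move=> f /(min_primes_sub minS); apply: var_prime_sub.
    exact: finset.subsetUr.
  rewrite minJ => -[minT iT] TS; exists T; split=> //; split=> //.
  by apply: disjointWl TS _; rewrite disjoint_sym disjoint_setU1 iu disjoint_sym.
have [[S1 [minS1 S1u]]|noS] :=
  pselect (exists S, min_primes I S /\ [disjoint S & (i |: u)%SET]%B).
  have := S1u; rewrite disjU => /andP [iS1 S1u'].
  have [T [FT iT _]] := shed S1 (conj minS1 S1u') iS1.
  apply: (cap_primes_split (i := i)) => //.
  - by move=> S T' [minS _] [minT' _]; apply: (@min_primes_antichain I).
  - by exists S1.
  - by apply: decI; exists T.
  rewrite (_ : [set S : {set 'I_n} | _ /\ i \notin S]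
             = [set S | min_primes I S /\ [disjoint S & (i |: u)%SET]%B]).
    by apply: decN; exists S1.
  apply/seteqP; split=> S /=; rewrite disjU; first by move=> [[minS ->] ->].
  by move=> [minS /andP [-> ->]].
have allI S : min_primes I S /\ [disjoint S & u]%B -> i \in S.
  move=> [minS Su]; apply: contrapT => /negP iS; apply: noS; exists S.
  by rewrite disjU iS.
rewrite (_ : [set S : {set 'I_n} | _ /\ _]
           = [set S | (min_primes I S /\ [disjoint S & u]%B) /\ i \in S]).
  by apply: decI; exists S0; split=> //; apply: allI.
by apply/seteqP; split=> S /=; [move=> FS; split=> //; apply: allI | case].
Qed.

End MonomialIdeals.

Theorem lemma3p5 (K : fieldType) (n : nat) (I : set {mpoly K[n]})
    (monI : monomial_ideal I) (unmI : unmixed I) (decI : ass_decomposable I) :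
  ass_decomposable (radical I).
Proof.
have antiI : ass_antichain I by move=> p q; apply: unmixed_ass_antichain.
have propI : is_proper_ideal I by case: decI.
have [S minS] := min_primes_exists monI propI.
have disj0 (T : {set 'I_n}) : [disjoint T & finset.set0]%B.
  by apply/pred0P => j; rewrite !inE andbF.
have link0 := ass_decomposable_link decI antiI (u := finset.set0).
rewrite radical_monomial //.
rewrite (_ : min_primes I
           = [set T | min_primes I T /\ [disjoint T & finset.set0]%B]).
  by apply: link0; exists S.
by apply/seteqP; split=> T /=; [split | case].
Qed.
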